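(* Let $K_1,\dots,K_n\in\mathcal F_0$ and $\mathbf K=(K_1,\dots,K_n)$. (i) For $p\ge 0$, $$\inf_{\mathbf L\in\mathcal S_0^n}\Big\{nV_p(\mathbf K;\mathbf L^\circ)^{\frac{n}{n+p}}\,\widetilde V(\mathbf L)^{\frac{p}{n+p}}\Big\}=\inf_{\mathbf L\in\mathcal S_0^n}\Big\{nV_p(\mathbf K;\mathbf L^\circ)^{\frac{n}{n+p}}\prod_{i=1}^n|L_i|^{\frac{p}{(n+p)n}}\Big\}=\inf_{L\in\mathcal S_0}\Big\{nV_p(\mathbf K;L^\circ,\dots,L^\circ)^{\frac{n}{n+p}}|L|^{\frac{p}{n+p}}\Big\}.$$ (ii) For $-n<p<0$, $$\sup_{\mathbf L\in\mathcal S_0^n}\Big\{nV_p(\mathbf K;\mathbf L^\circ)^{\frac{n}{n+p}}\,\widetilde V(\mathbf L)^{\frac{p}{n+p}}\Big\}=\sup_{\mathbf L\in\mathcal S_0^n}\Big\{nV_p(\mathbf K;\mathbf L^\circ)^{\frac{n}{n+p}}\prod_{i=1}^n|L_i|^{\frac{p}{(n+p)n}}\Big\}=\sup_{L\in\mathcal S_0}\Big\{nV_p(\mathbf K;L^\circ,\dots,L^\circ)^{\frac{n}{n+p}}|L|^{\frac{p}{n+p}}\Big\}.$$ (iii) For $p<-n$, $$\sup_{\mathbf L\in\mathcal S_0^n}\Big\{nV_p(\mathbf K;\mathbf L^\circ)^{\frac{n}{n+p}}\,\widetilde V(\mathbf L)^{\frac{p}{n+p}}\Big\}=\sup_{L\in\mathcal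 S_0}\Big\{nV_p(\mathbf K;L^\circ,\dots,L^\circ)^{\frac{n}{n+p}}|L|^{\frac{p}{n+p}}\Big\}.$$
   Context: Notation in $\mathbb R^n$: $S^{n-1}$ is the unit sphere with spherical measure $\sigma$ and $|\cdot|$ is volume. $\mathcal K_0$ is the set of convex bodies (compact convex sets) containing the origin in their interior; $h_K(u)=\max_{x\in K}\langle x,u\rangle$ is the support function. $\mathcal F_0$ is the set of $K\in\mathcal K_0$ whose surface area measure $S(K,\cdot)$ on $S^{n-1}$ is absolutely continuous with respect to $\sigma$; $f_K$ denotes its density (curvature function of $K$), and for $p\in\mathbb R$, $f_p(K,u)=h_K(u)^{1-p}f_K(u)$. $\mathcal S_0$ is the set of star-convex bodies about the origin: sets $L\subset\mathbb R^n$, star-convex about $0$ (for each $x\in L$ the segment from $0$ to $x$ lies in $L$), whose radial function $\rho_L(u)=\max\{\lambda\ge0:\lambda u\in L\}$, $u\in S^{n-1}$, is positive and continuous. $|L|=\frac1n\int_{S^{n-1}}\rho_L^n\,d\sigma$. For $\mathbf L=(L_1,\dots,L_n)\in\mathcal S_0^n$ one writes $\mathbf L^\circ=(L_1^\circ,\dots,L_n^\circ)$ and $$V_p(\mathbf K;\mathbf L^\circ)=\frac1n\int_{S^{n-1}}\prod_{i=1}^n\big[\rho_{L_i}(u)^{-p}f_p(K_i,u)\big]^{\frac1n}d\sigma(u),\qquad \widetilde V(\mathbf L)=\frac1n\int_{S^{n-1}}\prod_{i=1}^n\rho_{L_i}(u)\,d\sigma(u).$$ $V_p(\mathbf K;L^\circ,\dots,L^\circ)$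 is the case $L_1=\dots=L_n=L$. Infima and suprema are taken in $[0,+\infty]$, with $0^a=+\infty$ for $a<0$. *)

(* Defs.v *)
From HB Require Import structures.
From mathcomp Require Import all_boot all_order all_algebra.
From mathcomp Require Import all_classical all_reals all_analysis.
From mathcomp Require Import measurable_realfun.

Set Implicit Arguments.
Unset Strict Implicit.
Unset Printing Implicit Defensive.

Import Order.TTheory GRing.Theory Num.Theory.
Import numFieldNormedType.Exports.

Local Open Scope classical_set_scope.
Local Open Scope ring_scope.

Section borel_rV.
Context {R : realType} {n : nat}.

Definition borel_rV : set (set 'rV[R]_n) := <<s open >>.

HB.instance Definition _ := @isMeasurable.Build
  (sigma_display (@open 'rV[R]_n)) 'rV[R]_n borel_rV
  (@sigma_algebra0 _ setT open) (@sigma_algebraC _ open)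
  (@sigma_algebra_bigcup _ setT open).

End borel_rV.

Lemma open_measurable_rV (R : realType) (n : nat) (U : set 'rV[R]_n) :
  open U -> measurable U.
Proof. exact: sub_sigma_algebra. Qed.

Lemma measurable_coord (R : realType) (n : nat) (i : 'I_n) :
  measurable_fun [set: 'rV[R]_n] (fun x : 'rV[R]_n => x ord0 i).
Proof.
apply: (measurability _ (RGenOpens.measurableE R)).
move=> _ [_ [a [b ->] <-]]; rewrite setTI; apply: open_measurable_rV.
by apply: open_comp => [x _|]; [exact: coord_continuous|exact: interval_open].
Qed.

Lemma open_rV_bigcup (R : realType) (n : nat) (U : set 'rV[R]_n) : open U ->
  U = \bigcup_(qk : 'rV[rat]_n * nat)
      (if `[< ball (map_mx ratr qk.1 : 'rV[R]_n) qk.2.+1%:R^-1 `<=` U >]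
       then ball (map_mx ratr qk.1 : 'rV[R]_n) qk.2.+1%:R^-1 else set0).
Proof.
move=> oU; apply/seteqP; split=> [x Ux|x [qk _]]; last first.
  by case: ifPn => // /asboolP; exact.
have /nbhs_ballP[e /= e0 xeU] : nbhs x U by exact: open_nbhs_nbhs.
have e20 : 0 < e / 2 by rewrite divr_gt0.
have [k _ ke] := near_infty_natSinv_lt (PosNum e20).
have {}ke := ke k (leqnn k); rewrite /= in ke.
have k0 : 0 < k.+1%:R^-1 :> R by rewrite invr_gt0.
have H (i : 'I_n) : exists q : rat, ball (x ord0 i) k.+1%:R^-1 (ratr q).
  have [] : ball (x ord0 i) k.+1%:R^-1 `&` range (@ratr R) !=set0.
    by apply: dense_rat; [exists (x ord0 i); exact: ballxx|exact: ball_open].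
  by move=> _ [/[swap] -[q _ <-]]; exists q.
pose q := \row_i projT1 (cid (H i)) : 'rV[rat]_n.
have xq : ball x k.+1%:R^-1 (map_mx ratr q : 'rV[R]_n).
  split => // i j; rewrite !mxE ord1.
  by case: cid.
exists (q, k) => //=.
rewrite asboolT; first exact/ball_sym.
move=> y qy; apply: xeU; rewrite (splitr e).
by apply: (ball_triangle (le_ball (ltW ke) xq)); exact: (le_ball (ltW ke) qy).
Qed.

Lemma measurable_fun_rVP d (T : measurableType d) (R : realType) (n : nat)
    (f : T -> 'rV[R]_n) :
  measurable_fun setT f <-> forall i, measurable_fun setT (fun t => f t ord0 i).
Proof.
split=> [mf i|mf].
  exact: (measurableT_comp (measurable_coord i) mf).
apply: (@measurability _ _ T 'rV[R]_n setT f open) => // _ [U oU <-]; rewrite setTI.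
rewrite (open_rV_bigcup oU) preimage_bigcup.
apply: countable_bigcupT_measurable => // -[q k]; case: ifPn => _; last first.
  by rewrite preimage_set0.
have -> : f @^-1` ball (map_mx ratr (q, k).1 : 'rV[R]_n) (q, k).2.+1%:R^-1 =
    \bigcap_(i in [set: 'I_n])
      (fun t => f t ord0 i) @^-1` ball (ratr (q ord0 i) : R) k.+1%:R^-1.
  apply/seteqP; split=> [t [_ /= h] i _ /=|t /= h].
    by have := h ord0 i; rewrite mxE.
  split => [|i j]; first by rewrite invr_gt0.
  by rewrite ord1 mxE; exact: h.
apply: fin_bigcap_measurable => // i _; rewrite -[X in measurable X]setTI.
by apply: mf => //; apply: open_measurable; exact: ball_open.
Qed.


Section image_measure.
Context d d' (T : measurableType d) (T' : measurableType d') (R : realType).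
Variables (mu : {measure set T -> \bar R}) (f : {mfun T >-> T'}).

Definition image_measure : set T' -> \bar R := pushforward mu f.

Let image_measure0 : image_measure set0 = 0%E.
Proof. exact: measure0. Qed.

Let image_measure_ge0 A : (0 <= image_measure A)%E.
Proof. exact: measure_ge0. Qed.

Let image_measure_sigma_additive : semi_sigma_additive image_measure.
Proof. exact: measure_semi_sigma_additive. Qed.

HB.instance Definition _ := isMeasure.Build _ _ _ image_measure
  image_measure0 image_measure_ge0 image_measure_sigma_additive.

End image_measure.

Section lebesgue_tuple.
Context {R : realType}.
Local Notation mR := (measurableTypeR R).

Definition tcons n (xt : mR * n.-tuple mR) : n.+1.-tuple mR :=
  [tuple of xt.1 :: xt.2].

Definition tuncons n (t : n.+1.-tuple mR) : mR * n.-tuple mR :=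
  (thead t, [tuple of behead t]).

Lemma tconsK n : cancel (@tcons n) (@tuncons n).
Proof. by case=> x t; congr pair; apply/val_inj. Qed.

Lemma measurable_tcons n : measurable_fun setT (@tcons n).
Proof. exact: measurable_cons. Qed.

Lemma measurable_tuncons n : measurable_fun setT (@tuncons n).
Proof.
apply: measurable_fun_pair; first exact: measurable_tnth.
exact: measurable_behead.
Qed.

HB.instance Definition _ n :=
  isMeasurableFun.Build _ _ _ _ (@tcons n) (@measurable_tcons n).

Section step.
Context {n : nat} (mu : {sigma_finite_measure set (n.-tuple mR) -> \bar R}).

Definition lebesgue_tupleS : set (n.+1.-tuple mR) -> \bar R :=
  image_measure (@lebesgue_measure R \x mu)%E (@tcons n).

HB.instance Definition _ := Measure.on lebesgue_tupleS.

Let lebesgue_tupleS_sigma_finite : sigma_finite setT lebesgue_tupleS.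
Proof.
have /sigma_finiteP[F [FT ndF Foo]] := sigma_finiteT (@lebesgue_measure R).
have /sigma_finiteP[G [GT ndG Goo]] := sigma_finiteT mu.
exists (fun k => @tuncons n @^-1` (F k `*` G k)).
  rewrite -preimage_bigcup; apply/esym; rewrite -subTset => t _ /=.
  have [k _ Fk] : (\bigcup_k F k) (tuncons t).1 by rewrite -FT.
  have [l _ Gl] : (\bigcup_k G k) (tuncons t).2 by rewrite -GT.
  exists (maxn k l) => //; split.
    by move: Fk; exact/subsetPset/ndF/leq_maxl.
  by move: Gl; exact/subsetPset/ndG/leq_maxr.
move=> k; have [mFk Fkoo] := Foo k; have [mGk Gkoo] := Goo k; split.
  rewrite -[X in measurable X]setTI; apply: measurable_tuncons => //.
  exact: measurableX.
rewrite /lebesgue_tupleS /image_measure /pushforward -comp_preimage.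
rewrite (_ : _ \o _ = idfun) ?preimage_id; last first.
  by apply/funext => x /=; rewrite tconsK.
suff : (lebesgue_measure (F k) * mu (G k) < +oo)%E.
  by rewrite -(product_measure1E (@lebesgue_measure R) mu mFk mGk).
by rewrite lte_mul_pinfty// ge0_fin_numE.
Qed.

HB.instance Definition _ := Measure_isSigmaFinite.Build _ _ _
  lebesgue_tupleS lebesgue_tupleS_sigma_finite.

End step.

Fixpoint lebesgue_tuple n : {sigma_finite_measure set (n.-tuple mR) -> \bar R} :=
  match n with
  | 0 => @dirac _ _ [tuple] R
  | m.+1 => lebesgue_tupleS (lebesgue_tuple m)
  end.

End lebesgue_tuple.

Section lebesgue_rV.
Context {R : realType} (n : nat).
Local Notation mR := (measurableTypeR R).

Definition row_of_tuple (t : n.-tuple mR) : 'rV[R]_n := \row_i tnth t i.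

Lemma measurable_row_of_tuple : measurable_fun setT row_of_tuple.
Proof.
apply/measurable_fun_rVP => i.
rewrite (_ : (fun t => _) = (@tnth n mR ^~ i)); first exact: measurable_tnth.
by apply/funext => t; rewrite mxE.
Qed.

HB.instance Definition _ :=
  isMeasurableFun.Build _ _ _ _ row_of_tuple measurable_row_of_tuple.

Definition lebesgue_rV : {measure set 'rV[R]_n -> \bar R} :=
  image_measure (lebesgue_tuple n) row_of_tuple.

End lebesgue_rV.

Section euclidean.
Context {R : realType} {n : nat}.
Implicit Types x y : 'rV[R]_n.

Definition dotp x y : R := \sum_i x ord0 i * y ord0 i.

(* The library norm on 'rV[R]_n is the sup norm. *)
Definition enorm x : R := Num.sqrt (dotp x x).

Definition sphere : set 'rV[R]_n := [set u | enorm u = 1].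

Definition punctured_ball : set 'rV[R]_n := [set x | 0 < enorm x <= 1].

Definition normalize x : 'rV[R]_n := (enorm x)^-1 *: x.

Lemma measurable_enorm : measurable_fun setT enorm.
Proof.
apply: (measurableT_comp (continuous_measurable_fun (@sqrt_continuous R))).
by apply: measurable_sum => i; apply: measurable_funM; exact: measurable_coord.
Qed.

Lemma measurable_punctured_ball : measurable punctured_ball.
Proof.
rewrite (_ : punctured_ball = setT `&` enorm @^-1` `]0, 1]).
  by apply: measurable_enorm => //; exact: measurable_itv.
by rewrite setTI; apply/seteqP; split=> x; rewrite /= in_itv.
Qed.

Lemma measurable_normalize : measurable_fun setT normalize.
Proof.
apply/measurable_fun_rVP => i.
rewrite (_ : (fun x => _) = (fun x => enorm x `^ (-1) * x ord0 i)); last first.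
  by apply/funext => x; rewrite mxE powR_inv1// sqrtr_ge0.
apply: measurable_funM; last exact: measurable_coord.
exact: measurableT_comp (measurable_powR _) measurable_enorm.
Qed.

HB.instance Definition _ :=
  isMeasurableFun.Build _ _ _ _ normalize measurable_normalize.

(* Spherical Lebesgue measure, in its cone form:
   sphere_measure w = n * |{t *: u | u in w, 0 < t <= 1}|. *)
Definition sphere_measure : {measure set 'rV[R]_n -> \bar R} :=
  mscale n%:R%:nng
    (image_measure (mrestr (lebesgue_rV n) measurable_punctured_ball) normalize).

End euclidean.

Section convex_bodies.
Context {R : realType} {n : nat}.
Implicit Types (K L A w : set 'rV[R]_n) (u : 'rV[R]_n) (f : 'rV[R]_n -> R).

Definition support K u : R := sup [set dotp x u | x in K].

Definition is_convex_body0 K : Prop :=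
  [/\ compact K, convex_set (K : set (convex_lmodType 'rV[R]_n)) & K° 0].

Definition diameter A : \bar R :=
  ereal_sup [set r | exists x y, [/\ A x, A y & r = (enorm (x - y))%:E]].

Definition ball_volume m : \bar R :=
  lebesgue_rV m [set x : 'rV[R]_m | enorm x <= 1].

Definition hausdorff_weight m A : \bar R :=
  if A == set0 then 0%E else
  (ball_volume m * ((2^-1)%:E * diameter A) ^+ m)%E.

Definition hausdorff_pre m (d : R) A : \bar R :=
  ereal_inf [set (\sum_(0 <= k <oo) hausdorff_weight m (U k))%E |
    U in [set U : (set 'rV[R]_n)^nat |
      A `<=` \bigcup_k U k /\ forall k, (diameter (U k) <= d%:E)%E]].

(* The m-dimensional Hausdorff outer measure, normalized so that it agrees
   with m-dimensional volume on m-dimensional flats. *)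
Definition hausdorff m A : \bar R :=
  ereal_sup [set hausdorff_pre m d A | d in [set d : R | 0 < d]].

(* S(K, w): the (n-1)-dimensional measure of the boundary points of K having
   an outer unit normal in w; <x, u> = h_K(u) forces x to lie on the boundary
   of K, with outer normal u. *)
Definition surface_area K w : \bar R :=
  hausdorff n.-1 [set x | K x /\
    exists u, [/\ sphere u, w u & dotp x u = support K u]].

Definition class_F0 K : Prop :=
  is_convex_body0 K /\ surface_area K `<< sphere_measure.

(* f is (a version of) f_K, the density of S(K, .) with respect to the
   spherical measure. *)
Definition is_curvature_function K f : Prop :=
  [/\ measurable_fun sphere f,
      forall u, sphere u -> 0 <= f u &
      forall w, measurable w -> w `<=` sphere ->
        surface_area K w = (\int[sphere_measure]_(u in w) (f u)%:E)%E].

(* f_p(K, u), where f is the curvature function of K. *)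
Definition p_curvature (p : R) K f u : R := support K u `^ (1 - p) * f u.

Definition radial L u : R := sup [set l : R | 0 <= l /\ L (l *: u)].

(* The first two clauses on u say that the maximum defining the radial
   function exists. *)
Definition is_star_body L : Prop :=
  [/\ forall x, L x -> forall t : R, 0 <= t <= 1 -> L (t *: x),
      forall u, sphere u ->
        [/\ has_ubound [set l : R | 0 <= l /\ L (l *: u)],
            L (radial L u *: u) & 0 < radial L u] &
      {within sphere, continuous (radial L)}].

Definition volume L : \bar R := lebesgue_rV n L.

End convex_bodies.

Section mixed_volumes.
Context {R : realType} {n : nat}.
Implicit Types (K L : 'I_n -> set 'rV[R]_n) (f : 'I_n -> 'rV[R]_n -> R).

(* V_p(K_1, ..., K_n; L_1^o, ..., L_n^o), where f i is the curvature function
   of K_i; the polars L_i^o enter only through the radial functions of the L_i. *)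
Definition mixed_volume_polar (p : R) K f L : \bar R :=
  ((n%:R^-1)%:E * \int[sphere_measure]_(u in sphere)
    (\prod_(i < n)
      (radial (L i) u `^ (- p) * p_curvature p (K i) (f i) u) `^ n%:R^-1)%:E)%E.

Definition dual_mixed_volume L : \bar R :=
  ((n%:R^-1)%:E * \int[sphere_measure]_(u in sphere)
    (\prod_(i < n) radial (L i) u)%:E)%E.

Definition star_bodies : set ('I_n -> set 'rV[R]_n) :=
  [set L | forall i, is_star_body (L i)].

End mixed_volumes.

(* Powers of x in [0, +oo]. The library's poweR follows other conventions for a
   negative exponent: 0 `^ a = 0 and +oo `^ a = +oo. *)
Definition epow {R : realType} (x : \bar R) (a : R) : \bar R :=
  if a < 0 then
    if x == 0%E then +oo%E else if x == +oo%E then 0%E else (x `^ a)%E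
  else (x `^ a)%E.

(* Main.v *)
(* Given L_1, ..., L_n, let M be the star body whose radial function is the
   geometric mean of those of the L_i.  Then V_p(K; L^o) = V_p(K; M^o, ..., M^o)
   pointwise under the integral, and the dual mixed volume of L is |M|, so the
   first and the last functional take the same set of values, for every p.  The
   diagonal also embeds into the product functional, and Hoelder's inequality
   dual_mixed_volume L <= prod |L_i|^(1/n) gives the remaining comparison, its
   direction being decided by the sign of p / (n + p).

   The identity |L| = (1/n) int rho_L^n for the cone form of the spherical
   measure is obtained by cutting the sphere into the sets where
   e^(dz) <= rho_L < e^(d(z+1)), z an integer: there, both sides agree up to the
   factor e^(dn) by the scaling of Lebesgue measure, and d tends to 0. *)

Require Import Defs.
From HB Require Import structures.
From mathcomp Require Import all_boot all_order all_algebra.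
From mathcomp Require Import all_classical all_reals all_analysis.
From mathcomp Require Import measurable_realfun ring.

Set Implicit Arguments.
Unset Strict Implicit.

Import Order.TTheory GRing.Theory Num.Theory.
Import numFieldNormedType.Exports.

Local Open Scope classical_set_scope.
Local Open Scope ring_scope.

(** * Lebesgue measure of dilates and of cubes, on tuples *)

Section lebesgue_tuple_scaling.
Context {R : realType}.
Local Notation mR := (measurableTypeR R).

(** The measure [mu], t times the image of Lebesgue measure under multiplication by t, gives []a,
    b]] the mass b - a; uniqueness of Lebesgue measure identifies the two. *)
Lemma lebesgue_measure_scale (t : R) (A : set mR) : 0 < t -> measurable A ->
  lebesgue_measure ((fun x : mR => t * x) @^-1` A) =
  (t^-1%:E * lebesgue_measure A)%E.
Proof.
move=> t0 mA.
have mt : measurable_fun [set: mR] (fun x : mR => t * x : mR).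
  exact: measurable_funM.
pose h : {mfun mR >-> mR} := HB.pack (fun x : mR => t * x : mR)
  (isMeasurableFun.Build _ _ _ _ (fun x : mR => t * x : mR) mt).
pose mu : {measure set mR -> \bar R} :=
  mscale (NngNum (ltW t0)) (image_measure (@lebesgue_measure R) h).
have muE B :
    mu B = (t%:E * lebesgue_measure ((fun x : mR => t * x)%R @^-1` B))%E.
  by [].
have -> : lebesgue_measure A = mu A.
  apply: lebesgue_measure_unique => // _ [[a b]] _ <-.
  rewrite muE.
  have -> : (fun x : mR => t * x) @^-1` `]a, b]%classic =
      `](a / t), (b / t)]%classic.
    apply/seteqP; split=> x /=; rewrite !in_itv/=.
      by rewrite ltr_pdivrMr// ler_pdivlMr// ![x * t]mulrC.
    by rewrite ltr_pdivrMr// ler_pdivlMr// ![x * t]mulrC.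
  rewrite !lebesgue_measure_itv/= !lte_fin ltr_pM2r ?invr_gt0//.
  case: ifPn => _; last by rewrite mule0.
  by rewrite -!EFinB -EFinM -mulrBl mulrCA divff ?mulr1// gt_eqF.
by rewrite muE muleA -EFinM mulVf ?mul1e// gt_eqF.
Qed.

Definition scale_tuple n (t : R) (x : n.-tuple mR) : n.-tuple mR :=
  map_tuple (fun y => t * y) x.

Lemma measurable_scale_tuple n (t : R) :
  measurable_fun setT (@scale_tuple n t).
Proof.
apply/measurable_fun_tnthP => i.
rewrite (_ : _ \o _ = fun x => t * tnth x i); last first.
  by apply/funext => x /=; rewrite tnth_map.
by apply: measurable_funM => //; exact: measurable_tnth.
Qed.

Lemma lebesgue_tupleSE n (A : set (n.+1.-tuple mR)) :
  lebesgue_tuple n.+1 A =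
  (lebesgue_measure \x lebesgue_tuple n)%E (@tcons R n @^-1` A).
Proof. by []. Qed.

(** Induction on the dimension. On rectangles, t^(n+1) times the image of the product measure under
    the dilation agrees with the product measure, by the one-dimensional case and the induction
    hypothesis; uniqueness of the product measure extends this to all measurable sets. *)
Lemma lebesgue_tuple_scale n (t : R) (A : set (n.-tuple mR)) :
  0 < t -> measurable A ->
  lebesgue_tuple n (scale_tuple t @^-1` A) =
  ((t ^- n)%:E * lebesgue_tuple n A)%E.
Proof.
move=> t0; elim: n A => [|n ih] A mA.
  rewrite expr0 invr1 mul1e; congr (lebesgue_tuple 0 _).
  by apply/seteqP; split=> x /=; rewrite (tuple0 x) (tuple0 (scale_tuple _ _)).
pose g (x : mR * n.-tuple mR) : mR * n.-tuple mR :=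
  (t * x.1 : mR, scale_tuple t x.2).
have mg : measurable_fun setT g.
  apply: measurable_fun_pair; first exact: measurable_funM.
  exact: (measurableT_comp (measurable_scale_tuple t)
    (@measurable_snd _ _ mR (n.-tuple mR))).
pose h : {mfun (mR * n.-tuple mR)%type >-> (mR * n.-tuple mR)%type} :=
  HB.pack g (isMeasurableFun.Build _ _ _ _ g mg).
pose mu : {measure set (mR * n.-tuple mR) -> \bar R} :=
  mscale (NngNum (exprn_ge0 n.+1 (ltW t0)))
  (image_measure (lebesgue_measure \x lebesgue_tuple n)%E h).
have muE B : mu B =
    ((t ^+ n.+1)%R%:E * (lebesgue_measure \x lebesgue_tuple n)%E (g @^-1` B))%E.
  by [].
rewrite !lebesgue_tupleSE.
have mA' : measurable (@tcons R n @^-1` A).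
  by rewrite -[X in measurable X]setTI; exact: measurable_tcons.
rewrite [in RHS](@product_measure_unique _ _ _ _ _ _ _ mu) //; last first.
  move=> B C mB mC; rewrite muE.
  have -> : g @^-1` (B `*` C) =
    ((fun x : mR => t * x) @^-1` B) `*` (scale_tuple t @^-1` C) by [].
  rewrite product_measure1E; last 2 first.
  - by rewrite -[X in measurable X]setTI; exact: measurable_funM.
  - by rewrite -[X in measurable X]setTI; exact: measurable_scale_tuple.
  rewrite [X in (_ * (X * _))%E](lebesgue_measure_scale t0 mB).
  rewrite [X in (_ * (_ * X))%E](ih _ mC).
  rewrite muleACA muleA -EFinM muleA muleA -EFinM -invfM -exprS mulfV ?mul1e//.
  by rewrite gt_eqF ?exprn_gt0.
rewrite muE muleA -EFinM mulVf ?mul1e ?gt_eqF ?exprn_gt0//; congr (_ _).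
by apply/seteqP; split=> x /=; congr A; apply/val_inj.
Qed.

(** Serves twice later: with A a singleton the origin becomes a null set, and with A an interval
    cubes bound the volume of a star body from both sides. *)
Lemma lebesgue_tuple_box n (A : set mR) : measurable A ->
  lebesgue_tuple n [set x | forall i, A (tnth x i)] =
  (lebesgue_measure A ^+ n)%E.
Proof.
move=> mA; elim: n => [|n ih].
  rewrite expe0 /= diracE mem_set//= => -[].
  by [].
rewrite lebesgue_tupleSE expeS -ih.
have -> : @tcons R n @^-1` [set x | forall i, A (tnth x i)] =
    A `*` [set x | forall i, A (tnth x i)].
  apply/seteqP; split=> [[x s] /= h|[x s] /= [Ax As] i].
    split; first by have := h ord0; rewrite tnth0.
    by move=> i; have := h (lift ord0 i); rewrite tnthS.
  by case: (unliftP ord0 i) => [j ->|->]; rewrite ?tnthS ?tnth0.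
rewrite product_measure1E//.
rewrite (_ : mkset _ = \bigcap_(i in [set: 'I_n]) (@tnth n mR ^~ i @^-1` A)).
  apply: fin_bigcap_measurable => // i _; rewrite -[X in measurable X]setTI.
  exact: measurable_tnth.
by apply/seteqP; split=> x /=; [move=> h i _; exact: h|move=> h i; exact: h].
Qed.
End lebesgue_tuple_scaling.

(** * The same facts for row vectors *)

Section lebesgue_rV_scaling.
Context {R : realType} {n : nat}.

Lemma lebesgue_rVE (A : set 'rV[R]_n) :
  lebesgue_rV n A = lebesgue_tuple n (@row_of_tuple R n @^-1` A).
Proof. by []. Qed.

Lemma lebesgue_rV_scale (t : R) (A : set 'rV[R]_n) :
  0 < t -> measurable A ->
  lebesgue_rV n ((fun x => t *: x) @^-1` A) =
  ((t ^- n)%:E * lebesgue_rV n A)%E.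
Proof.
move=> t0 mA; rewrite !lebesgue_rVE -lebesgue_tuple_scale//; last first.
  by rewrite -[X in measurable X]setTI; exact: measurable_row_of_tuple.
congr (lebesgue_tuple n _); apply/seteqP.
by split=> x /=; congr A; apply/rowP => i; rewrite !mxE tnth_map.
Qed.

Lemma lebesgue_rV_box (A : set R) : measurable A ->
  lebesgue_rV n [set x | forall i, A (x ord0 i)] = (lebesgue_measure A ^+ n)%E.
Proof.
move=> mA; rewrite -(lebesgue_tuple_box n mA) lebesgue_rVE.
congr (lebesgue_tuple n _); apply/seteqP.
by split=> x /= + i => /(_ i); rewrite mxE.
Qed.

Lemma measurable_box (A : set R) : measurable A ->
  measurable [set x : 'rV[R]_n | forall i, A (x ord0 i)].
Proof.
move=> mA.
rewrite (_ : mkset _ =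
    \bigcap_(i in [set: 'I_n]) ((fun x : 'rV[R]_n => x ord0 i) @^-1` A)).
  apply: fin_bigcap_measurable => // i _; rewrite -[X in measurable X]setTI.
  exact: measurable_coord.
by apply/seteqP; split=> x /=; [move=> h i _; exact: h|move=> h i; exact: h].
Qed.

Lemma set1_rV0 : [set 0 : 'rV[R]_n] = [set x | forall i, [set 0] (x ord0 i)].
Proof.
apply/seteqP; split=> x /=; first by move=> -> i; rewrite mxE.
by move=> h; apply/rowP => i; rewrite h mxE.
Qed.

Lemma measurable_set1_rV0 : measurable [set 0 : 'rV[R]_n].
Proof. by rewrite set1_rV0; apply: measurable_box. Qed.

(** In dimension 0 the origin is the whole space and has mass 1. *)
Lemma lebesgue_rV_set10 : (0 < n)%N -> lebesgue_rV n [set 0 : 'rV[R]_n] = 0%E.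
Proof.
move=> n0; rewrite set1_rV0 lebesgue_rV_box// lebesgue_measure_set1.
by rewrite -(prednK n0) expeS mul0e.
Qed.

End lebesgue_rV_scaling.

(** * The Euclidean norm, normalization and the unit sphere *)

Section enorm_theory.
Context {R : realType} {n : nat}.
Implicit Types x u : 'rV[R]_n.

Lemma enorm_ge0 x : 0 <= enorm x.
Proof. exact: sqrtr_ge0. Qed.

Lemma enorm0 : enorm (0 : 'rV[R]_n) = 0.
Proof. by rewrite /enorm /dotp big1 ?sqrtr0// => i _; rewrite mxE mul0r. Qed.

Lemma enormZ (t : R) x : enorm (t *: x) = `|t| * enorm x.
Proof.
rewrite /enorm -sqrtr_sqr -sqrtrM ?sqr_ge0//; congr Num.sqrt.
by rewrite /dotp mulr_sumr; apply: eq_bigr => i _; rewrite !mxE expr2 mulrACA.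
Qed.

Lemma coord_le_enorm x i : `|x ord0 i| <= enorm x.
Proof.
rewrite -sqrtr_sqr ler_wsqrtr// /dotp (bigD1 i)//= expr2 lerDl.
by apply: sumr_ge0 => j _; rewrite -expr2 sqr_ge0.
Qed.

Lemma enorm_eq0 x : enorm x = 0 -> x = 0.
Proof.
move=> x0; apply/rowP => i; rewrite mxE; apply/eqP.
by rewrite -normr_le0 -x0 coord_le_enorm.
Qed.

Lemma enorm_gt0 x : x != 0 -> 0 < enorm x.
Proof.
by move=> x0; rewrite lt0r enorm_ge0 andbT; apply: contra_neq x0 => /enorm_eq0.
Qed.

(** The sharp factor would be the square root of n; the crude n, from n <= n^2, is enough to fit a
    cube into a star body. *)
Lemma enorm_le x (c : R) : 0 <= c -> (forall i, `|x ord0 i| <= c) ->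
  enorm x <= n%:R * c.
Proof.
move=> c0 xc; rewrite -(@ger0_norm _ (n%:R * c)) ?mulr_ge0// -sqrtr_sqr.
apply: ler_wsqrtr; apply: (@le_trans _ _ (n%:R * c ^+ 2)).
  rewrite /dotp -[n in n%:R]card_ord mulr_natl -sumr_const; apply: ler_sum.
  by move=> i _; rewrite -expr2 -real_normK ?num_real// lerXn2r// ?nnegrE.
rewrite exprMn; apply: ler_wpM2r; first exact: sqr_ge0.
by rewrite -natrX ler_nat; case: (n) => // m; rewrite leq_pmulr.
Qed.

Lemma sphere_neq0 u : sphere u -> u != 0.
Proof.
move=> su; apply: contra_eq_neq su => ->.
by rewrite enorm0 eq_sym oner_neq0.
Qed.

Lemma normalize0 : normalize (0 : 'rV[R]_n) = 0.
Proof. by rewrite /normalize scaler0. Qed.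

Lemma sphere_normalize x : x != 0 -> sphere (normalize x).
Proof.
move=> /enorm_gt0 x0; rewrite /sphere/= enormZ ger0_norm ?invr_ge0 ?ltW//.
by rewrite mulVf// gt_eqF.
Qed.

(** The origin is excluded because [normalize] fixes it. As an equality of propositions this can be
    rewritten inside preimages of the sphere. *)
Lemma sphere_normalizeE x : sphere (normalize x) = (x != 0) :> Prop.
Proof.
apply/propext; split=> [|/sphere_normalize//].
by move=> /sphere_neq0; apply: contra_neq => ->; rewrite normalize0.
Qed.

Lemma normalizeZ (t : R) x : 0 < t -> normalize (t *: x) = normalize x.
Proof.
move=> t0; rewrite /normalize enormZ gtr0_norm// invfM scalerA.
by rewrite mulrAC mulVf ?mul1r// gt_eqF.
Qed.

Lemma normalize_id u : sphere u -> normalize u = u.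
Proof. by rewrite /sphere/= /normalize => ->; rewrite invr1 scale1r. Qed.

Lemma scale_normalize x : enorm x *: normalize x = x.
Proof.
have [->|/enorm_gt0 x0] := eqVneq x 0; first by rewrite normalize0 scaler0.
by rewrite /normalize scalerA divff ?scale1r// gt_eqF.
Qed.

Lemma continuous_enorm : continuous (@enorm R n).
Proof.
have cdotp : continuous (fun x : 'rV[R]_n => dotp x x).
  apply: (@continuous_big _ _ +%R 0 xpredT _ _ _
    (fun i (x : 'rV[R]_n) => x ord0 i * x ord0 i)) => [|i _ x].
    exact: add_continuous.
  by apply: (@continuousM _ _ (fun y : 'rV[R]_n => y ord0 i));
    exact: coord_continuous.
by move=> x; apply: continuous_comp; [exact: cdotp|exact: sqrt_continuous].
Qed.

Lemma closed_sphere : closed (@sphere R n).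
Proof.
rewrite (_ : sphere = @enorm R n @^-1` [set 1]) //.
by apply: closed_comp => [x _|]; [exact: continuous_enorm|exact: closed_eq].
Qed.

Lemma measurable_sphere : measurable (@sphere R n).
Proof.
rewrite (_ : sphere = setT `&` @enorm R n @^-1` [set 1]) ?setTI//.
by rewrite -[X in measurable X]setTI; exact: measurable_enorm.
Qed.

Lemma compact_sphere : compact (@sphere R n).
Proof.
apply: bounded_closed_compact closed_sphere.
(* Boundedness refers to the sup norm, which the Euclidean norm dominates. *)
exists 1; split => // M M1 x xS; apply: le_trans (ltW M1).
rewrite /Num.norm/= mx_normrE; apply/bigmax_leP; split=> // -[i j] _ /=.
by rewrite ord1 -[leRHS]xS coord_le_enorm.
Qed.

(** Preimages of open intervals are relatively open, hence traces on the measurable sphere of open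
    sets of the whole space. *)
Lemma continuous_measurable_sphere (g : 'rV[R]_n -> R) :
  {within sphere, continuous g} -> measurable_fun sphere g.
Proof.
move=> /continuousP cg; apply: (measurability _ (RGenOpens.measurableE R)).
move=> _ [_ [a [b ->] <-]].
have /open_subspaceP[V oV VE] :=
  cg _ (@interval_open R (BRight a) (BLeft b) isT isT).
rewrite setIC -VE; apply: measurableI; last exact: measurable_sphere.
exact: open_measurable_rV.
Qed.

Lemma sphere_measureE (w : set 'rV[R]_n) : sphere_measure w =
  (n%:R%:E * lebesgue_rV n (normalize @^-1` w `&` punctured_ball))%E.
Proof. by []. Qed.

End enorm_theory.

(** * Integration in polar coordinates *)

Section polar_coordinates.
Context {R : realType} {n : nat}.
Implicit Types (w : set 'rV[R]_n) (g : 'rV[R]_n -> R).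

(** For w inside the sphere this is the set of all t *: u with u in w and 0 < t <= c; the origin is
    left out since [normalize 0] is not in w. *)
Definition cone w (c : R) : set 'rV[R]_n :=
  normalize @^-1` w `&` [set x | enorm x <= c].

(** Without the origin, [normalize] maps this set into the sphere, so a partition of the sphere
    induces one of the body. *)
Definition radial_body g : set 'rV[R]_n :=
  [set x | x != 0 /\ enorm x <= g (normalize x)].

Lemma measurable_cone w c : measurable w -> measurable (cone w c).
Proof.
move=> mw; apply: measurableI.
  by rewrite -[X in measurable X]setTI; exact: measurable_normalize.
rewrite (_ : mkset _ = setT `&` @enorm R n @^-1` `]-oo, c]).
  by rewrite setTI -[X in measurable X]setTI; apply: measurable_enorm.
by rewrite setTI; apply/seteqP; split=> x; rewrite /= in_itv.
Qed.

(** Since g is measurable on the sphere only, the defining inequality is read as a preimage of [[0,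
    +oo[] under a difference restricted to the nonzero vectors. *)
Lemma measurable_radial_body g :
  measurable_fun sphere g -> measurable (radial_body g).
Proof.
move=> mg.
have mD : measurable (normalize @^-1` @sphere R n).
  rewrite -[X in measurable X]setTI; apply: measurable_normalize => //.
  exact: measurable_sphere.
have -> : radial_body g = normalize @^-1` (@sphere R n) `&`
    (fun x => g (normalize x) - enorm x) @^-1` `[0, +oo[%classic.
  apply/seteqP; split=> x /=; rewrite in_itv/= andbT subr_ge0.
    by rewrite sphere_normalizeE.
  by rewrite sphere_normalizeE.
suff mf : measurable_fun (normalize @^-1` @sphere R n)
    (fun x => g (normalize x) - enorm x).
  by apply: mf.
apply: measurable_funB.
  apply: (@measurable_comp _ _ _ _ _ _ sphere) => //.
  - exact: measurable_sphere.
  - by move=> _ [x xS <-].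
  - exact: (measurable_funS measurableT _ measurable_normalize).
exact: (measurable_funS measurableT _ measurable_enorm).
Qed.

(** [cone w t] is the dilate by t of the cone of height 1 that defines [sphere_measure]. *)
Lemma lebesgue_rV_cone w (t : R) : measurable w -> w `<=` sphere -> 0 < t ->
  (n%:R%:E * lebesgue_rV n (cone w t) = (t ^+ n)%:E * sphere_measure w)%E.
Proof.
move=> mw wS t0.
have -> : cone w t =
    (fun x => t^-1 *: x) @^-1` (normalize @^-1` w `&` punctured_ball).
  apply/seteqP; split=> x /=; rewrite /cone/= normalizeZ ?invr_gt0//.
    move=> [wx xt]; split => //.
    have /enorm_gt0 x0 : x != 0 by rewrite -sphere_normalizeE; exact: wS.
    rewrite /punctured_ball/= enormZ gtr0_norm ?invr_gt0//.
    by rewrite mulr_gt0 ?invr_gt0//= mulrC ler_pdivrMr// mul1r.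
  move=> [wx]; rewrite /punctured_ball/= enormZ gtr0_norm ?invr_gt0//.
  by move=> /andP[_]; rewrite mulrC ler_pdivrMr// mul1r.
rewrite lebesgue_rV_scale ?invr_gt0//; last first.
  apply: measurableI; last exact: measurable_punctured_ball.
  by rewrite -[X in measurable X]setTI; exact: measurable_normalize.
by rewrite sphere_measureE exprVn invrK muleCA.
Qed.

Lemma nneseries_le_scale (u v : (\bar R)^nat) (s : R) :
  (forall k, 0 <= u k)%E -> (forall k, 0 <= v k)%E ->
  (forall k, u k <= s%:E * v k)%E ->
  (\sum_(0 <= k <oo) u k <= s%:E * \sum_(0 <= k <oo) v k)%E.
Proof.
by move=> u0 v0 uv; rewrite -nneseriesZl//; apply: lee_nneseries.
Qed.

(* The k-th level set lies over the integer z encoded by k; pickle_inv, unlike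
   unpickle, is injective, which makes the level sets disjoint. *)
Definition level g (d : R) (k : nat) : set 'rV[R]_n :=
  if pickle_inv k is Some z then
    sphere `&` g @^-1` `[expR (d * (z : int)%:~R), expR (d * (z + 1)%:~R)[
  else set0.

Lemma level_sphere g d k : level g d k `<=` sphere.
Proof. by rewrite /level; case: pickle_inv => // z x []. Qed.

Lemma measurable_level g d k :
  measurable_fun sphere g -> measurable (level g d k).
Proof.
move=> mg; rewrite /level; case: pickle_inv => // z.
by apply: mg => //; exact: measurable_sphere.
Qed.

Lemma level_bounds g d k : exists2 t, 0 < t &
  forall u, level g d k u -> t <= g u <= t * expR d.
Proof.
(* An index that encodes no integer gives an empty level, for which any positive t will do. *)
rewrite /level; case: pickle_inv => [z|]; last by exists 1.
exists (expR (d * z%:~R)); first exact: expR_gt0.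
move=> u [_ /=]; rewrite in_itv/= => /andP[-> /ltW/=].
by rewrite intrD mulrDr mulr1 expRD.
Qed.

(** The half-open bounds put ln (g u) / d into [z, z + 1[, so u determines z and two levels with a
    common point lie over the same integer. *)
Lemma level_floor g d k z u : 0 < d -> pickle_inv k = Some z ->
  level g d k u -> Num.floor (ln (g u) / d) = z.
Proof.
move=> d0; rewrite /level => -> [_ /=]; rewrite in_itv/= => /andP[h1 h2].
have g0 : 0 < g u by apply: lt_le_trans h1; exact: expR_gt0.
apply: floor_def; rewrite ler_pdivlMr// ltr_pdivrMr// ![_ * d]mulrC.
by rewrite -ler_expR -ltr_expR lnK// h1.
Qed.

Lemma trivIset_level g d : 0 < d -> trivIset setT (level g d).
Proof.
move=> d0 k l _ _ [u [uk ul]].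
have [z kz] : exists z : int, pickle_inv k = Some z.
  by move: uk; rewrite /level; case: pickle_inv => // z; exists z.
have [y ly] : exists y : int, pickle_inv l = Some y.
  by move: ul; rewrite /level; case: pickle_inv => // y; exists y.
have zy : z = y by rewrite -(level_floor d0 kz uk) (level_floor d0 ly ul).
have := @pickle_invK int k; have := @pickle_invK int l.
by rewrite kz ly /= zy => <- <-.
Qed.

Lemma bigcup_level g d : 0 < d -> (forall u, sphere u -> 0 < g u) ->
  \bigcup_k level g d k = sphere.
Proof.
move=> d0 g0; apply/seteqP; split=> [u [k _]|u uS]; first exact: level_sphere.
exists (pickle (Num.floor (ln (g u) / d))) => //.
rewrite /level pickleK_inv; split => //=; rewrite in_itv/=.
have /andP[] := floor_itv (ln (g u) / d).
rewrite ler_pdivlMr// ltr_pdivrMr// ![_ * d]mulrC => h1 h2.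
have gu := g0 u uS.
by rewrite -[leRHS]lnK// -[ltLHS]lnK// ler_expR ltr_expR h1.
Qed.

(* X and Y both lie between t^n and (t e^d)^n times the measure of the level
   set, where t is its lower bound. *)
Lemma polar_level g d k : measurable_fun sphere g ->
  let X := (n%:R%:E *
    lebesgue_rV n (radial_body g `&` normalize @^-1` level g d k))%E in
  let Y := (\int[sphere_measure]_(u in level g d k) (g u ^+ n)%:E)%E in
  (X <= (expR d ^+ n)%:E * Y)%E /\ (Y <= (expR d ^+ n)%:E * X)%E.
Proof.
move=> mg X Y; have [t t0 tg] := level_bounds g d k.
set w := level g d k in X Y tg *.
have mw : measurable w by exact: measurable_level.
have wS : w `<=` sphere by exact: level_sphere.
have mX : measurable (radial_body g `&` normalize @^-1` w).
  apply: measurableI; first exact: measurable_radial_body.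
  by rewrite -[X in measurable X]setTI; exact: measurable_normalize.
have mgn : measurable_fun w (fun u => (g u ^+ n)%:E).
  apply/measurable_EFinP; apply: measurable_funX.
  by apply: measurable_funS mg => //; exact: measurable_sphere.
have g0 u : w u -> 0 <= g u.
  by move=> /tg/andP[tgu _]; exact: le_trans (ltW t0) tgu.
have lowX : ((t ^+ n)%:E * sphere_measure w <= X)%E.
  rewrite -lebesgue_rV_cone//; apply: lee_wpmul2l => //.
  apply: le_measure; rewrite ?inE//; first exact: measurable_cone.
  move=> x [wx /= xt]; split => //; split.
    by rewrite -sphere_normalizeE; exact: wS.
  by have /andP[+ _] := tg _ wx; exact: le_trans.
have upX : (X <= ((t * expR d) ^+ n)%:E * sphere_measure w)%E.
  rewrite -lebesgue_rV_cone ?mulr_gt0 ?expR_gt0//; apply: lee_wpmul2l => //.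
  apply: le_measure; rewrite ?inE//; first exact: measurable_cone.
  move=> x [[_ xg] wx]; split => //=.
  by have /andP[_ +] := tg _ wx; exact: le_trans.
have lowY : ((t ^+ n)%:E * sphere_measure w <= Y)%E.
  rewrite -integral_cst//; apply: ge0_le_integral => //=.
  - by move=> u _; rewrite lee_fin exprn_ge0// ltW.
  - move=> u uw; rewrite lee_fin lerXn2r// ?nnegrE ?g0 ?(ltW t0)//.
    by have /andP[] := tg _ uw.
have upY : (Y <= ((t * expR d) ^+ n)%:E * sphere_measure w)%E.
  rewrite -integral_cst//; apply: ge0_le_integral => //=.
  - by move=> u uw; rewrite lee_fin exprn_ge0// g0.
  - move=> u uw; rewrite lee_fin lerXn2r// ?nnegrE ?g0//.
      by rewrite mulr_ge0 ?expR_ge0// ltW.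
    by have /andP[] := tg _ uw.
have scale Z : ((t ^+ n)%:E * sphere_measure w <= Z ->
    ((t * expR d) ^+ n)%:E * sphere_measure w <= (expR d ^+ n)%:E * Z)%E.
  move=> h; rewrite exprMn mulrC EFinM -muleA lee_pmul2l// lte_fin.
  by rewrite exprn_gt0// expR_gt0.
by split;
  [exact: le_trans upX (scale _ lowY)|exact: le_trans upY (scale _ lowX)].
Qed.

Lemma integral_sphere_radial g : (0 < n)%N ->
  measurable_fun sphere g -> (forall u, sphere u -> 0 < g u) ->
  (\int[sphere_measure]_(u in sphere) (g u ^+ n)%:E =
   n%:R%:E * lebesgue_rV n (radial_body g))%E.
Proof.
move=> n0 mg g0.
have mgn : measurable_fun sphere (fun u => (g u ^+ n)%:E).
  by apply/measurable_EFinP; exact: measurable_funX.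
set Y := (X in X = _); set X := (X in _ = X).
have Y0 : (0 <= Y)%E.
  by apply: integral_ge0 => u uS; rewrite lee_fin exprn_ge0// ltW ?g0.
have X0 : (0 <= X)%E by rewrite mule_ge0.
have key (d : R) : 0 < d ->
    (X <= (expR d ^+ n)%:E * Y)%E /\ (Y <= (expR d ^+ n)%:E * X)%E.
  move=> d0.
  have EY : Y = (\sum_(0 <= k <oo)
      \int[sphere_measure]_(u in level g d k) (g u ^+ n)%:E)%E.
    rewrite /Y -[in LHS](bigcup_level d0 g0) ge0_integral_bigcup//.
    - by move=> k; exact: measurable_level.
    - by rewrite bigcup_level.
    - move=> u; rewrite bigcup_level// => uS.
      by rewrite lee_fin exprn_ge0// ltW ?g0.
    - exact: trivIset_level.
  have EX : X = (\sum_(0 <= k <oo) (n%:R%:E * lebesgue_rV n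
      (radial_body g `&` normalize @^-1` level g d k)))%E.
    have gE : radial_body g =
        \bigcup_k (radial_body g `&` normalize @^-1` level g d k).
      rewrite -setI_bigcupr -preimage_bigcup bigcup_level//.
      apply/seteqP; split=> x; last by case.
      by move=> xg; split=> //=; rewrite sphere_normalizeE; case: xg.
    rewrite nneseriesZl// /X [in LHS]gE measure_bigcup; last 2 first.
    - move=> k _; apply: measurableI; first exact: measurable_radial_body.
      rewrite -[X in measurable X]setTI; apply: measurable_normalize => //.
      exact: measurable_level.
    - move=> k l _ _ [x [[_ xk] [_ xl]]].
      by apply: (@trivIset_level g d d0 k l I I); exists (normalize x).
    by congr (_ * _)%E; apply: eq_eseriesl => k; rewrite in_setT.
  rewrite EX EY; split; apply: nneseries_le_scale => k; do ?exact: mule_ge0.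
  - apply: integral_ge0 => u /level_sphere uS.
    by rewrite lee_fin exprn_ge0// ltW ?g0.
  - by have [] := polar_level d k mg.
  - apply: integral_ge0 => u /level_sphere uS.
    by rewrite lee_fin exprn_ge0// ltW ?g0.
  - by have [] := polar_level d k mg.
(* With d = - ln r / n the error factor e^(dn) is 1/r. Letting r tend to 1 replaces letting d tend
   to 0, and the conclusion X = Y also covers infinite values. *)
have {}key (r : R) : 0 < r < 1 -> (r%:E * X <= Y)%E /\ (r%:E * Y <= X)%E.
  move=> /andP[r0 r1]; pose d := - ln r / n%:R.
  have d0 : 0 < d by rewrite divr_gt0 ?ltr0n// oppr_gt0 ln_lt0// r0.
  have dr : expR d ^+ n = r^-1.
    by rewrite -expRM_natr divfK ?pnatr_eq0 -?lt0n// expRN lnK.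
  have [h1 h2] := key d d0; rewrite dr in h1 h2.
  by split; rewrite -lee_pdivlMl.
apply/eqP; rewrite eq_le; apply/andP; split; apply/lee_mul01Pr => // r r01.
  by have [] := key r r01.
by have [] := key r r01.
Qed.

End polar_coordinates.

(** * Star bodies, their radial functions and their volumes *)

Section star_bodies_theory.
Context {R : realType} {n : nat}.
Implicit Types (g : 'rV[R]_n -> R) (A : set 'rV[R]_n).

Lemma sphere_nonempty : (0 < n)%N -> exists u : 'rV[R]_n, sphere u.
Proof.
move=> n0; exists (normalize (delta_mx ord0 (Ordinal n0))).
apply: sphere_normalize; apply/eqP => /rowP/(_ (Ordinal n0)).
by rewrite !mxE !eqxx => /eqP; rewrite oner_eq0.
Qed.

(** The origin is reached by shrinking a point of A to 0, and such a point comes from a direction on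
    the sphere, which exists only for n > 0. *)
Lemma star_body0 A : (0 < n)%N -> is_star_body A -> A 0.
Proof.
move=> n0 [sA bA _]; have [u uS] := sphere_nonempty n0.
have [_ Au _] := bA _ uS; rewrite -(scale0r (radial A u *: u)).
by apply: sA => //; rewrite lexx ler01.
Qed.

(** If x is in A, then [enorm x] is one of the radii whose supremum is [radial]. Conversely, x lies
    on the segment from 0 to the farthest point of A in its direction. *)
Lemma in_star_body A x : is_star_body A -> x != 0 ->
  A x <-> enorm x <= radial A (normalize x).
Proof.
move=> [sA bA _] x0; have xS := sphere_normalize x0.
have [ubA Ar r0] := bA _ xS; split => [Ax|xr].
  apply: sup_upper_bound; last by rewrite /= enorm_ge0 scale_normalize.
  split => //; exists (enorm x).
  by rewrite /= enorm_ge0 scale_normalize.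
have := sA _ Ar (enorm x / radial A (normalize x)).
rewrite scalerA divfK ?gt_eqF// scale_normalize; apply.
apply/andP; split; first by rewrite divr_ge0 ?enorm_ge0// ltW.
by rewrite ler_pdivrMr// mul1r.
Qed.

Lemma star_bodyE A : (0 < n)%N -> is_star_body A ->
  A = radial_body (radial A) `|` [set 0].
Proof.
move=> n0 sA; apply/seteqP; split=> x.
  have [->|x0] := eqVneq x 0; first by right.
  by move/(in_star_body sA x0) => ?; left.
by move=> [[x0 /(in_star_body sA x0)]//|->]; exact: star_body0.
Qed.

Lemma measurable_radial A : is_star_body A -> measurable_fun sphere (radial A).
Proof. by move=> [_ _]; exact: continuous_measurable_sphere. Qed.

Lemma measurable_star_body A : (0 < n)%N -> is_star_body A -> measurable A.
Proof.
move=> n0 sA; rewrite (star_bodyE n0 sA); apply: measurableU.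
  exact: measurable_radial_body (measurable_radial sA).
exact: measurable_set1_rV0.
Qed.

Lemma radial_gt0 A u : is_star_body A -> sphere u -> 0 < radial A u.
Proof. by move=> [_ + _] uS => /(_ _ uS)[]. Qed.

Lemma integral_radial A : (0 < n)%N -> is_star_body A ->
  (\int[sphere_measure]_(u in sphere) (radial A u ^+ n)%:E =
   n%:R%:E * volume A)%E.
Proof.
move=> n0 sA; rewrite integral_sphere_radial//; last 2 first.
- exact: measurable_radial.
- by move=> u; exact: radial_gt0.
congr (_ * _)%E; rewrite /volume [in RHS](star_bodyE n0 sA) measureU0//.
- exact: measurable_radial_body (measurable_radial sA).
- exact: measurable_set1_rV0.
- exact: lebesgue_rV_set10.
Qed.

Lemma dual_mixed_volume_diag A : (0 < n)%N -> is_star_body A ->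
  dual_mixed_volume (fun _ : 'I_n => A) = volume A.
Proof.
move=> n0 sA; rewrite /dual_mixed_volume.
under eq_integral do rewrite prodr_const card_ord.
rewrite integral_radial// muleA -EFinM mulVf ?mul1e// pnatr_eq0.
by rewrite -lt0n.
Qed.

(** A positive finite volume keeps [epow] away from its exceptional values. The radial function
    attains its extrema on the compact sphere; the maximum gives a cube around A, the minimum a cube
    inside A. *)
Lemma volume_star_body A : (0 < n)%N -> is_star_body A ->
  exists2 v : R, 0 < v & volume A = v%:E.
Proof.
move=> n0 sA; have [_ _ cA] := sA.
have S0 : @sphere R n !=set0 by have [u ?] := sphere_nonempty n0; exists u.
have mA := measurable_star_body n0 sA.
have [u /set_mem uS umax] := compact_EVT_max S0 compact_sphere cA.
have [v /set_mem vS vmin] := compact_EVT_min S0 compact_sphere cA.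
have nR : 0 < n%:R :> R by rewrite ltr0n.
have u0 := radial_gt0 sA uS; have v0 := radial_gt0 sA vS.
set I1 : set R := `[- radial A u, radial A u]%classic.
(* The division by n compensates the factor in [enorm_le]; the open end at 0 keeps the origin out,
   as [in_star_body] requires. *)
set I2 : set R := `]0, radial A v / n%:R]%classic.
have mI1 : measurable I1 by exact: measurable_itv.
have mI2 : measurable I2 by exact: measurable_itv.
have up : (volume A <= lebesgue_measure I1 ^+ n)%E.
  rewrite -lebesgue_rV_box//; apply: le_measure; rewrite ?inE//.
    exact: measurable_box.
  move=> x; have [-> _ i|x0] := eqVneq x 0.
    by rewrite mxE /I1/= in_itv/= oppr_le0 ltW.
  move/(in_star_body sA x0) => xr i; rewrite /I1/= in_itv/= -ler_norml.
  rewrite (le_trans (coord_le_enorm _ _))// (le_trans xr)// umax//.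
  exact/mem_set/sphere_normalize.
have low : (lebesgue_measure I2 ^+ n <= volume A)%E.
  rewrite -lebesgue_rV_box//; apply: le_measure; rewrite ?inE//.
    exact: measurable_box.
  move=> x xI; have x0 : x != 0.
    apply/eqP => x0; have := xI (Ordinal n0).
    by rewrite x0 mxE /I2/= in_itv/= ltxx.
  apply/(in_star_body sA x0).
  apply: (@le_trans _ _ (radial A v)); last first.
    exact/vmin/mem_set/sphere_normalize.
  rewrite -[leRHS](divfK (lt0r_neq0 nR)) mulrC.
  apply: enorm_le => [|i]; first by rewrite divr_ge0// ltW.
  by have := xI i; rewrite /I2/= in_itv/= => /andP[/gtr0_norm->].
have fin1 : lebesgue_measure I1 \is a fin_num.
  by rewrite lebesgue_measure_itv/=; case: ifP.
have gt2 : (0 < lebesgue_measure I2 ^+ n)%E.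
  rewrite lebesgue_measure_itv/= lte_fin divr_gt0//.
  by rewrite -EFinB -EFin_expe lte_fin exprn_gt0// subr0 divr_gt0.
have fin : volume A \is a fin_num.
  rewrite ge0_fin_numE ?measure_ge0//; apply: le_lt_trans up _.
  by rewrite ltey_eq fin_numX.
exists (fine (volume A)); last by rewrite fineK.
by rewrite -lte_fin fineK//; exact: lt_le_trans gt2 low.
Qed.

(* normalize 0 = 0, so g constrains nothing at the origin: hence the first
   disjunct. *)
Definition star_of g : set 'rV[R]_n :=
  [set x | x = 0 \/ enorm x <= g (normalize x)].

(** Because the segment is closed, the supremum defining [radial] is attained, at g u. The end l = 0
    is treated apart, as a direction survives scaling only by positive factors. *)
Lemma ray_star_of g u : (forall v, sphere v -> 0 < g v) -> sphere u ->
  [set l : R | 0 <= l /\ star_of g (l *: u)] = `[0, g u]%classic.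
Proof.
move=> g0 uS; have gu := g0 u uS.
apply/seteqP; split=> l /=; rewrite in_itv/=.
  move=> [l0 lu]; rewrite l0/=; move: l0.
  rewrite (le_eqVlt 0) => /predU1P[<-|l0].
    exact: ltW.
  case: lu => [/eqP|].
    by rewrite scaler_eq0 gt_eqF//= (negbTE (sphere_neq0 uS)).
  by rewrite normalizeZ// normalize_id// enormZ uS mulr1 gtr0_norm.
move=> /andP[l0 lu]; split => //; move: l0.
rewrite (le_eqVlt 0) => /predU1P[<-|l0].
  by left; rewrite scale0r.
by right; rewrite normalizeZ// normalize_id// enormZ uS mulr1 gtr0_norm.
Qed.

Lemma radial_star_of g u : (forall v, sphere v -> 0 < g v) -> sphere u ->
  radial (star_of g) u = g u.
Proof.
by move=> g0 uS; rewrite /radial ray_star_of// sup_itvcc// ltW// g0.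
Qed.

Lemma is_star_body_star_of g : (forall v, sphere v -> 0 < g v) ->
  {within sphere, continuous g} -> is_star_body (star_of g).
Proof.
move=> g0 cg; split.
- move=> x [->|xg] t /andP[t0 t1]; first by left; rewrite scaler0.
  move: t0; rewrite (le_eqVlt 0) => /predU1P[<-|t0].
    by left; rewrite scale0r.
  right; rewrite normalizeZ// enormZ gtr0_norm//; apply: le_trans xg.
  by rewrite ler_piMl ?enorm_ge0.
- move=> u uS; split.
  + by exists (g u) => l; rewrite ray_star_of//= in_itv/= => /andP[].
  + rewrite radial_star_of//.
    have : [set l : R | 0 <= l /\ star_of g (l *: u)] (g u).
      by rewrite ray_star_of//= in_itv/= lexx ltW// g0.
    by case.
  + by rewrite radial_star_of// g0.
- apply: subspace_eq_continuous cg => u /set_mem uS.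
  by apply/esym; exact: radial_star_of.
Qed.

End star_bodies_theory.

(** * Powers of products, and powers in the extended half-line *)

Lemma powR_prod (R : realType) (I : finType) (F : I -> R) (a : R) :
  (forall i, 0 <= F i) -> (\prod_i F i) `^ a = \prod_i F i `^ a.
Proof.
move=> F0.
(* Nonnegativity of the partial products is carried along, since [powRM] asks for it. *)
suff: 0 <= \prod_i F i /\ (\prod_i F i) `^ a = \prod_i F i `^ a by case.
elim/big_rec2: _ => [|i x y _ [y0 <-]]; first by rewrite powR1.
by rewrite mulr_ge0// powRM.
Qed.

(** The n equal factors on the right cancel the n-th root, and exponents commute. With a = - p this
    is why passing to the geometric mean leaves the integrand of [mixed_volume_polar] unchanged. *)
Lemma prod_powR_mean (R : realType) (n : nat) (r : 'I_n -> R) (a : R) :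
  (0 < n)%N ->
  \prod_(i < n) (r i `^ a) `^ n%:R^-1 =
  \prod_(i < n) ((\prod_(j < n) r j `^ n%:R^-1) `^ a) `^ n%:R^-1.
Proof.
move=> n0; rewrite [RHS]prodr_const card_ord -powR_mulrn ?powR_ge0//.
rewrite -[RHS]powRrM mulVf ?pnatr_eq0 -?lt0n// powRr1 ?powR_ge0//.
rewrite powR_prod => [|i]; last exact: powR_ge0.
by apply: eq_bigr => i _; rewrite -!powRrM mulrC.
Qed.

Lemma epow_EFin (R : realType) (r : R) (a : R) :
  0 < r -> epow r%:E a = (r `^ a)%:E.
Proof.
by move=> r0; rewrite /epow; case: ifP => //; rewrite eqe gt_eqF.
Qed.

Lemma epow_ge0 (R : realType) (x : \bar R) (a : R) : (0 <= epow x a)%E.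
Proof.
rewrite /epow; case: ifP => _; last exact: poweR_ge0.
by case: ifP => _ //; case: ifP => _ //; exact: poweR_ge0.
Qed.

(** * The geometric mean of star bodies and Hoelder's inequality *)

Section geometric_mean.
Context {R : realType} {n : nat}.
Hypothesis n_gt0 : (0 < n)%N.
Variable L : 'I_n -> set 'rV[R]_n.
Hypothesis sL : star_bodies L.

Let nR : n%:R != 0 :> R.
Proof. by rewrite pnatr_eq0 -lt0n. Qed.

Definition mean_radial (u : 'rV[R]_n) : R :=
  \prod_(i < n) radial (L i) u `^ n%:R^-1.

Definition mean_star : set 'rV[R]_n := star_of mean_radial.

Let radial0 i u : sphere u -> 0 < radial (L i) u.
Proof. exact: radial_gt0 (sL i). Qed.

Lemma mean_radial_gt0 u : sphere u -> 0 < mean_radial u.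
Proof. by move=> uS; apply: prodr_gt0 => i _; rewrite powR_gt0// radial0. Qed.

Lemma mean_radialX u : sphere u ->
  mean_radial u ^+ n = \prod_(i < n) radial (L i) u.
Proof.
move=> uS; rewrite -prodrXl; apply: eq_bigr => i _.
by rewrite -powR_mulrn ?powR_ge0// -powRrM mulVf// powRr1// ltW ?radial0.
Qed.

Lemma continuous_mean_radial : {within sphere, continuous mean_radial}.
Proof.
have cM : continuous (fun x : R * R => x.1 * x.2).
  by move=> x; apply: continuousM; [exact: cvg_fst|exact: cvg_snd].
apply: (@continuous_big R 'I_n *%R 1 xpredT cM (subspace sphere)
  (index_enum 'I_n)
  (fun i (v : subspace sphere) => radial (L i) v `^ n%:R^-1)) => i _.
have [_ _ cr] := sL i.
(* On the sphere the radial function is positive, so the power is [expR] of a multiple of [ln], a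
   composite of continuous maps. *)
apply: (@subspace_eq_continuous _ _ _
  (fun v => expR (n%:R^-1 * ln (radial (L i) v)))).
  by move=> u /set_mem uS; rewrite /powR gt_eqF// radial0.
rewrite continuous_subspace_in => u /set_mem uS.
apply: (@continuous_comp (subspace sphere) _ _
  (fun v => n%:R^-1 * ln (radial (L i) v)) expR); last exact: continuous_expR.
apply: cvgM; first exact: cvg_cst.
apply: (@continuous_comp (subspace sphere) _ _ (radial (L i)) (@ln R)).
  exact: cr.
exact/continuous_ln/radial0.
Qed.

Lemma is_star_body_mean : is_star_body mean_star.
Proof.
apply: is_star_body_star_of; last exact: continuous_mean_radial.
exact: mean_radial_gt0.
Qed.

Lemma radial_mean u : sphere u -> radial mean_star u = mean_radial u.
Proof. exact/radial_star_of/mean_radial_gt0. Qed.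

Lemma dual_mixed_volume_mean : dual_mixed_volume L = volume mean_star.
Proof.
rewrite -(dual_mixed_volume_diag n_gt0 is_star_body_mean) /dual_mixed_volume.
congr (_ * _)%E; apply: eq_integral => u /set_mem uS.
by rewrite prodr_const card_ord radial_mean// mean_radialX.
Qed.

(** The integrands agree at each point: nonnegativity of f lets the n-th roots split into radial and
    curvature factors, and [prod_powR_mean] treats the radial ones. *)
Lemma mixed_volume_polar_mean p (K : 'I_n -> set 'rV[R]_n) f :
  (forall i u, sphere u -> 0 <= f i u) ->
  mixed_volume_polar p K f L = mixed_volume_polar p K f (fun=> mean_star).
Proof.
move=> f0; pose I (A : 'I_n -> set 'rV[R]_n) (u : 'rV[R]_n) : \bar R :=
  (\prod_(i < n)
    (radial (A i) u `^ (- p) * p_curvature p (K i) (f i) u) `^ n%:R^-1)%:E.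
suff eqI : {in sphere, I L =1 I (fun=> mean_star)}.
  have mvE A : mixed_volume_polar p K f A =
      (n%:R^-1%:E * \int[sphere_measure]_(u in sphere) I A u)%E by [].
  rewrite (mvE L) (mvE (fun=> mean_star)).
  apply: (congr1 (fun x => n%:R^-1%:E * x)%E).
  apply: eq_integral.
  exact: eqI.
move=> u /set_mem uS.
have g0 i : 0 <= p_curvature p (K i) (f i) u by rewrite mulr_ge0 ?powR_ge0// f0.
have IE A : I A u = ((\prod_(i < n) (radial (A i) u `^ (- p)) `^ n%:R^-1) *
    \prod_(i < n) p_curvature p (K i) (f i) u `^ n%:R^-1)%:E.
  rewrite -big_split/=; congr EFin; apply: eq_bigr => i _.
  by rewrite powRM ?powR_ge0.
apply: (eq_trans (IE L)); apply: (eq_trans _ (esym (IE (fun=> mean_star)))).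
apply: (congr1 (fun x => (x * _)%:E)).
apply: (eq_trans (prod_powR_mean (fun i => radial (L i) u) (- p) n_gt0)).
by apply: eq_bigr => i _; rewrite (radial_mean uS).
Qed.

(** Hoelder's inequality for n functions, obtained by integrating the inequality of arithmetic and
    geometric means for the radial functions normalized by c i = |L_i|^(1/n). *)
Lemma dual_mixed_volume_le (v : 'I_n -> R) :
  (forall i, 0 < v i) -> (forall i, volume (L i) = (v i)%:E) ->
  (dual_mixed_volume L <= (\prod_(i < n) v i `^ n%:R^-1)%:E)%E.
Proof.
move=> v0 vE; pose c i := v i `^ n%:R^-1; pose C := \prod_i c i.
have c0 i : 0 < c i by rewrite powR_gt0.
have C0 : 0 < C by apply: prodr_gt0.
have cn i : c i ^+ n = v i.
  by rewrite -powR_mulrn ?powR_ge0// -powRrM mulVf// powRr1// ltW.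
have amgm u : sphere u -> \prod_(i < n) radial (L i) u <=
    \sum_(i < n) C / (n%:R * v i) * radial (L i) u ^+ n.
  move=> uS; pose E i := radial (L i) u / c i.
  have E0 i : 0 <= E i by rewrite divr_ge0 ?ltW ?radial0.
  have -> : \prod_(i < n) radial (L i) u = C * \prod_i E i.
    rewrite -big_split/=; apply: eq_bigr => i _.
    by rewrite mulrC divfK// gt_eqF.
  have -> : \sum_(i < n) C / (n%:R * v i) * radial (L i) u ^+ n =
      C * ((\sum_i E i ^+ n) / n%:R).
    rewrite mulr_suml mulr_sumr; apply: eq_bigr => i _.
    by rewrite /E expr_div_n cn invfM; ring.
  (* [leif_AGM], applied to the n-th powers of the E i, bounds their product by the n-th power of
     their mean; hence n-th powers are compared. *)
  rewrite ler_pM2l// -(@ler_pXn2r _ n)// ?nnegrE ?prodr_ge0//; last first.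
    by rewrite divr_ge0// sumr_ge0// => i _; exact: exprn_ge0.
  have /(_ _)[|+ _] := @leif_AGM R 'I_n predT (fun i => E i ^+ n).
    by move=> i _; exact: exprn_ge0.
  by rewrite card_ord prodrXl.
have mr i : measurable_fun sphere (radial (L i)) by exact: measurable_radial.
have mrn i : measurable_fun sphere (fun u => radial (L i) u ^+ n).
  exact: measurable_funX.
have Cv0 i : 0 <= C / (n%:R * v i) by rewrite divr_ge0 ?ltW// mulr_gt0 ?ltr0n.
rewrite /dual_mixed_volume lee_pdivrMl ?ltr0n//.
apply: (@le_trans _ _ (\int[sphere_measure]_(u in sphere)
  \sum_(i < n) ((C / (n%:R * v i))%:E * (radial (L i) u ^+ n)%:E))%E).
  apply: ge0_le_integral => //=.
  - exact: measurable_sphere.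
  - by move=> u uS; rewrite lee_fin prodr_ge0// => i _; rewrite ltW ?radial0.
  - by apply/measurable_EFinP; apply: measurable_prod => i _; exact: mr.
  - apply: emeasurable_sum => i; apply/measurable_EFinP.
    exact: measurable_funM.
  - move=> u uS; rewrite -(eq_bigr _ (fun i _ => EFinM _ _)) sumEFin lee_fin.
    exact: amgm.
rewrite ge0_integral_sum; last 3 first.
- exact: measurable_sphere.
- by move=> i; apply/measurable_EFinP; apply: measurable_funM.
- by move=> i u uS; rewrite -EFinM lee_fin mulr_ge0// exprn_ge0// ltW// radial0.
(* The weight C / (n * v i) is such that every summand integrates to C. *)
under eq_bigr => i _.
  rewrite ge0_integralZl_EFin//; last 3 first.
  - exact: measurable_sphere.
  - by move=> u uS; rewrite lee_fin exprn_ge0// ltW// radial0.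
  - exact/measurable_EFinP.
  rewrite (integral_radial n_gt0 (sL i)) vE -!EFinM divfK; last first.
    by rewrite mulf_neq0// gt_eqF.
  over.
by rewrite /= sumEFin -EFinM lee_fin sumr_const card_ord mulr_natl.
Qed.

End geometric_mean.

(** * Comparison of the three functionals *)

Lemma prod_epow_volume (R : realType) (n : nat) (L : 'I_n -> set 'rV[R]_n)
    (v : 'I_n -> R) (b : R) :
  (forall i, 0 < v i) -> (forall i, volume (L i) = (v i)%:E) ->
  (\prod_(i < n) epow (volume (L i)) (n%:R^-1 * b) =
   epow (\prod_(i < n) v i `^ n%:R^-1)%:E b)%E.
Proof.
move=> v0 vE; rewrite epow_EFin; last first.
  by apply: prodr_gt0 => i _; rewrite powR_gt0.
rewrite powR_prod => [|i]; last exact: powR_ge0.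
rewrite -prodEFin; apply: eq_bigr => i _.
by rewrite vE epow_EFin// powRrM.
Qed.

Unset Implicit Arguments.

Theorem proposition3p1 (R : realType) (n : nat) (p : R)
    (K : 'I_n -> set 'rV[R]_n) (f : 'I_n -> 'rV[R]_n -> R)
    (n_gt0 : (0 < n)%N)
    (KF0 : forall i, class_F0 (K i))
    (fK : forall i, is_curvature_function (K i) (f i)) :
  let a : R := n%:R / (n%:R + p) in
  let b : R := p / (n%:R + p) in
  let V L := epow (mixed_volume_polar p K f L) a in
  let dual_values :=
    [set (n%:R%:E * V L * epow (dual_mixed_volume L) b)%E
      | L in star_bodies] in
  let product_values :=
    [set (n%:R%:E * V L *
          \prod_(i < n) epow (volume (L i)) (p / ((n%:R + p) * n%:R)))%E
      | L in star_bodies] in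
  let diagonal_values :=
    [set (n%:R%:E * V (fun=> L) * epow (volume L) b)%E
      | L in [set L : set 'rV[R]_n | is_star_body L]] in
  [/\ 0 <= p ->
        ereal_inf dual_values = ereal_inf product_values /\
        ereal_inf product_values = ereal_inf diagonal_values,
      - n%:R < p < 0 ->
        ereal_sup dual_values = ereal_sup product_values /\
        ereal_sup product_values = ereal_sup diagonal_values &
      p < - n%:R ->
        ereal_sup dual_values = ereal_sup diagonal_values].
Proof.
move=> a b V dual_values product_values diagonal_values.
have nR : 0 < n%:R :> R by rewrite ltr0n.
have f0 i u : sphere u -> 0 <= f i u by have [_ + _] := fK i; apply.
have pb : p / ((n%:R + p) * n%:R) = n%:R^-1 * b by rewrite invfM /b; ring.
have nV0 L : (0 <= n%:R%:E * V L)%E by rewrite mule_ge0// epow_ge0.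
have dual_diag : dual_values = diagonal_values.
  apply/seteqP; split=> _ [L sL <-].
    exists (mean_star L); first exact: is_star_body_mean.
    by rewrite /V -mixed_volume_polar_mean// -dual_mixed_volume_mean.
  exists (fun=> L) => //.
  by rewrite dual_mixed_volume_diag.
have diag_prod : diagonal_values `<=` product_values.
  move=> _ [L sL <-]; exists (fun=> L) => //; congr (_ * _)%E.
  have [v v0 vE] := volume_star_body n_gt0 sL.
  rewrite pb (@prod_epow_volume _ _ _ (fun=> v))// prodr_const card_ord vE.
  by rewrite -powR_mulrn ?powR_ge0// -powRrM mulVf ?gt_eqF// powRr1// ltW.
(* At a fixed L the dual and the product functional differ only in the base, s or c, of a power with
   exponent b, so the sign of b decides which is larger. *)
have volumes L : star_bodies L -> exists s c : R, [/\ 0 < s, s <= c,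
    dual_mixed_volume L = s%:E &
    (\prod_(i < n) epow (volume (L i)) (p / ((n%:R + p) * n%:R)))%E =
      epow c%:E b].
  move=> sL.
  have /choice[v vP] i : exists v : R, 0 < v /\ volume (L i) = v%:E.
    by have [v v0 vE] := volume_star_body n_gt0 (sL i); exists v.
  exists (fine (dual_mixed_volume L)), (\prod_(i < n) v i `^ n%:R^-1).
  have vE i : volume (L i) = (v i)%:E by have [] := vP i.
  have v0 i : 0 < v i by have [] := vP i.
  have [m m0 mE] := volume_star_body n_gt0 (is_star_body_mean sL).
  have dE : dual_mixed_volume L = m%:E by rewrite dual_mixed_volume_mean.
  rewrite dE/= pb (prod_epow_volume _ v0 vE); split => //.
  by rewrite -lee_fin -dE; exact: dual_mixed_volume_le.
split.
- move=> p0; have b0 : 0 <= b by rewrite divr_ge0// addr_ge0.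
  (* With [diag_prod] this gives infima dual <= product <= diagonal, and the two ends coincide by
     [dual_diag]. *)
  suff le_dp : (ereal_inf dual_values <= ereal_inf product_values)%E.
    have le_pd : (ereal_inf product_values <= ereal_inf diagonal_values)%E.
      exact: ereal_inf_le_tmp.
    rewrite -dual_diag in le_pd *.
    by split; apply/eqP; rewrite eq_le le_dp le_pd.
  apply: le_ereal_inf_tmp => _ [L sL <-].
  have [s [c [s0 sc sE ->]]] := volumes L sL.
  apply: ge_ereal_inf.
  exists (n%:R%:E * V L * epow (dual_mixed_volume L) b)%E; first by exists L.
  have c0 := lt_le_trans s0 sc.
  rewrite lee_wpmul2l// sE !epow_EFin// lee_fin.
  by apply: ge0_ler_powR => //; rewrite nnegrE ltW.
- move=> /andP[np p0].
  have b0 : 0 <= - b.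
    by rewrite -mulNr divr_ge0 ?oppr_ge0 ?ltW// -ltrBlDl sub0r.
  suff le_pd : (ereal_sup product_values <= ereal_sup dual_values)%E.
    have le_dp : (ereal_sup diagonal_values <= ereal_sup product_values)%E.
      exact: ereal_sup_le.
    rewrite -dual_diag in le_dp *.
    by split; apply/eqP; rewrite eq_le le_dp le_pd.
  apply: ge_ereal_sup => _ [L sL <-].
  have [s [c [s0 sc sE ->]]] := volumes L sL.
  apply: le_ereal_sup_tmp.
  exists (n%:R%:E * V L * epow (dual_mixed_volume L) b)%E; first by exists L.
  have c0 := lt_le_trans s0 sc.
  rewrite lee_wpmul2l// sE !epow_EFin// lee_fin.
  (* Here n + p > 0 and p < 0 make b negative: the powers with exponent - b are increasing in the
     base, and taking inverses reverses the order. *)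
  rewrite -[b]opprK [leLHS]powRN [leRHS]powRN lef_pV2 ?posrE ?powR_gt0//.
  by apply: ge0_ler_powR => //; rewrite nnegrE ltW.
- by rewrite dual_diag.
Qed.
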